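(* Let $G$ be a countable discrete amenable group, let $\pi:\mathbf{X}\to\mathbf{Y}$ and $\pi':\mathbf{X}'\to\mathbf{Y}'$ be extensions of measure-preserving $G$-systems, and suppose that there are a factor map $\bar\phi:\mathbf{X}\to\mathbf{X}'$ and an isomorphism $\phi:\mathbf{Y}\to\mathbf{Y}'$ such that $\pi'\circ\bar\phi=\phi\circ\pi$ almost everywhere. Then $$h_{\mathrm{slow}}^{U,(F_n)}(\mathbf{X}'\,|\,\pi')\ \le\ h_{\mathrm{slow}}^{U,(F_n)}(\mathbf{X}\,|\,\pi)$$ for every rate function $U$ and every F\o lner sequence $(F_n)$ for $G$.
   Context: A (left) F\o lner sequence for $G$ is a sequence of finite nonempty sets $F_n\subseteq G$ with $|gF_n\cap F_n|/|F_n|\to 1$ for each $g\in G$. A system $\mathbf{X}=(X,\mathcal{B}_X,\mu,T)$ is a measure-preserving action $T=(T^g)_{g\in G}$ (with $T^{gh}=T^gT^h$) on a standard probability space. A factor map (equivalently, an extension) $\pi:\mathbf{X}\to\mathbf{Y}=(Y,\mathcal{B}_Y,\nu,S)$ is a measurable map with $\pi_*\mu=\nu$ and $\pi T^g=S^g\pi$ a.e.; an isomorphism is a factor map invertible modulo null sets. For an extension $\pi$, $\mu=\int\mu_y\,d\nu(y)$ denotes the disintegration of $\mu$ over $\pi$. All partitions are finite and measurable. For $P=\{P_0,\dots,P_{r-1}\}$, $P(x)$ is the index $i$ with $x\in P_i$. For finite $F\subseteq G$, $d_{P,F}(x,x')=\frac1{|F|}\sum_{f\in F}1_{P(T^fx)\ne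 P(T^fx')}$, and $\operatorname{diam}_{P,F}$ is the diameter with respect to this pseudo-metric. For a probability measure $\lambda$ on $X$ and $\epsilon>0$, $\operatorname{cov}(\lambda,P,F,\epsilon)$ is the smallest $M$ such that there exist $E_1,\dots,E_M\subseteq X$ with $\operatorname{diam}_{P,F}(E_i)\le\epsilon$ for all $i$ and $\lambda(\bigcup E_i)\ge1-\epsilon$. The relative covering number is $$\operatorname{cov}(\mu,P,F,\epsilon\,|\,\pi)=\inf_{S'\subseteq Y:\ \nu(S')\ge1-\epsilon}\ \sup_{y\in S'}\operatorname{cov}(\mu_y,P,F,\epsilon).$$ A rate function is an increasing function $U:\mathbb{N}\to(0,\infty)$ with $U(n)\to\infty$. The relative slow entropy is $$h_{\mathrm{slow}}^{U,(F_n)}(\mathbf{X},P\,|\,\pi)=\sup_{\epsilon>0}\limsup_{n\to\infty}\frac{\operatorname{cov}(\mu,P,F_n,\epsilon\,|\,\pi)}{U(|F_n|)},\qquad h_{\mathrm{slow}}^{U,(F_n)}(\mathbf{X}\,|\,\pi)=\sup_P h_{\mathrm{slow}}^{U,(F_n)}(\mathbf{X},P\,|\,\pi),$$ with values in $[0,\infty]$, the last supremum being over all partitions $P$ of $X$. *)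

(* Defs.v *)
From HB Require Import structures.
From mathcomp Require Import all_boot all_order all_algebra finmap.
From mathcomp Require Import all_classical all_reals all_analysis.

Set Implicit Arguments.
Unset Strict Implicit.
Unset Printing Implicit Defensive.

Import Order.TTheory GRing.Theory Num.Theory.
Import numFieldNormedType.Exports.

Local Open Scope classical_set_scope.
Local Open Scope ring_scope.

(* `groupType` is the library's type of arbitrary, possibly infinite, groups
   written multiplicatively. *)
Definition folner_sequence (R : realType) (G : groupType)
    (F : nat -> {fset G}) : Prop :=
  (forall n, F n != fset0) /\
  (forall g : G,
     (fun n => #|` ([fset (g * f)%g | f in F n] `&` F n)%fset |%:R
               / #|` F n|%:R : R) @ \oo --> (1 : R)).

Definition amenable (R : realType) (G : groupType) : Prop :=
  exists F : nat -> {fset G}, folner_sequence R F.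

(* T is isomorphic, as a measurable space, to a complete separable metric space
   M with the sigma-algebra generated by its open sets. *)
Definition standard_borel (R : realType) d (T : measurableType d) : Prop :=
  exists (M : metricType R) (f : T -> M),
    [/\ bijective f,
        (forall H : set_system M, ProperFilter H -> cauchy H ->
           exists x : M, H --> x),
        (exists2 D : set M, countable D & dense D) &
        forall A : set T, measurable A <-> <<s open >> (f @` A)].

Record mp_system (R : realType) (G : groupType) := MPSystem {
  sys_display : measure_display;
  sys_space :> measurableType sys_display;
  sys_measure : probability sys_space R;
  sys_standard : standard_borel R sys_space;
  sys_act : G -> sys_space -> sys_space;
  sys_act_measurable : forall g, measurable_fun setT (sys_act g);
  sys_act_preserving : forall g (A : set sys_space), measurable A ->
    sys_measure (sys_act g @^-1` A) = sys_measure A;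
  sys_act1 : forall x, sys_act 1%g x = x;
  sys_actM : forall g h x, sys_act (g * h)%g x = sys_act g (sys_act h x)
}.

Section Factors.
Context {R : realType} {G : groupType}.
Implicit Types X Y : mp_system R G.

Definition factor_map X Y (p : X -> Y) : Prop :=
  [/\ measurable_fun setT p,
      (forall B : set Y, measurable B ->
         pushforward (sys_measure X) p B = sys_measure Y B) &
      forall g, {ae sys_measure X, forall x,
        p (sys_act g x) = sys_act g (p x)}].

(* An a.e. inverse q is automatically a factor map. *)
Definition system_isomorphism X Y (p : X -> Y) : Prop :=
  factor_map p /\
  exists q : Y -> X,
    [/\ measurable_fun setT q,
        {ae sys_measure X, forall x, q (p x) = x} &
        {ae sys_measure Y, forall y, p (q y) = y}].

(* k is the disintegration y |-> mu_y over p; being a probability kernel, it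
   sends every y to a probability measure, and y |-> k y A is measurable. *)
Definition is_disintegration X Y (p : X -> Y) (k : R.-pker Y ~> X) : Prop :=
  (forall A : set X, measurable A ->
     sys_measure X A = (\int[sys_measure Y]_y k y A)%E) /\
  {ae sys_measure Y, forall y, k y (p @^-1` [set y]) = 1%E}.

End Factors.

(* The partition whose cells are the fibres of its index function x |-> P(x).
   Cells may be empty. *)
Record fin_partition d (T : measurableType d) := FinPartition {
  fp_card : nat;
  fp_index :> T -> 'I_fp_card;
  fp_measurable : forall i, measurable (fp_index @^-1` [set i])
}.

Section SlowEntropy.
Context {R : realType} {G : groupType}.
Implicit Types (X Y : mp_system R G) (F : {fset G}) (eps : R).

Definition hamming X (P : fin_partition X) F (x x' : X) : R :=
  #|` F|%:R^-1 *
  \sum_(f <- F) (P (sys_act f x) != P (sys_act f x'))%:R.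

(* The diameter of the empty set is 0. *)
Definition diam X (P : fin_partition X) F (E : set X) : R :=
  sup [set r | exists x x', [/\ E x, E x' & r = hamming P F x x']].

Definition coverable X (lam : {measure set X -> \bar R}) (P : fin_partition X)
    F eps (M : nat) : Prop :=
  exists E : 'I_M -> set X,
    [/\ forall i, measurable (E i),
        forall i, diam P F (E i) <= eps &
        ((1 - eps)%:E <= lam (\bigcup_i E i))%E].

Definition cov X (lam : {measure set X -> \bar R}) (P : fin_partition X)
    F eps : \bar R :=
  ereal_inf [set M%:R%:E | M in coverable lam P F eps].

(* The supremum is taken in [0, +oo], whence `maxe 0`: it is 0 when S is empty,
   which is allowed for eps >= 1. *)
Definition rel_cov X Y (k : R.-pker Y ~> X) (P : fin_partition X)
    F eps : \bar R :=
  ereal_inf [set maxe 0%E (ereal_sup [set cov (k y) P F eps | y in S]) |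
    S in [set S : set Y |
      measurable S /\ ((1 - eps)%:E <= sys_measure Y S)%E]].

Definition rate_function (U : nat -> R) : Prop :=
  [/\ forall n, 0 < U n,
      {homo U : m n / (m <= n)%N >-> m <= n} &
      U @ \oo --> +oo].

Definition rel_slow_entropy_part X Y (k : R.-pker Y ~> X) (U : nat -> R)
    (F : nat -> {fset G}) (P : fin_partition X) : \bar R :=
  ereal_sup [set limn_esup (fun n => rel_cov k P (F n) eps
                                     / (U #|` F n|)%:E)%E |
    eps in [set eps : R | 0 < eps]].

(* The extension pi enters only through its disintegration k. *)
Definition rel_slow_entropy X Y (k : R.-pker Y ~> X) (U : nat -> R)
    (F : nat -> {fset G}) : \bar R :=
  ereal_sup [set rel_slow_entropy_part k U F P | P in [set: fin_partition X]].

End SlowEntropy.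

(* Main.v *)
Require Import Defs.
From HB Require Import structures.
From mathcomp Require Import all_boot all_order all_algebra finmap.
From mathcomp Require Import all_classical all_reals all_analysis.
From mathcomp Require Import measurable_realfun.

Set Implicit Arguments.
Unset Strict Implicit.
Unset Printing Implicit Defensive.

Import Order.TTheory GRing.Theory Num.Theory.
Import numFieldNormedType.Exports.

Local Open Scope classical_set_scope.
Local Open Scope ring_scope.

(** A partition P' of X' pulls back along phibar to a partition P of X, and the
whole proof compares the covering numbers of P' in the fibres of pi' with those
of P in the fibres of pi.

The Hamming distance between two points over F depends only on their names,
that is, on the functions f |-> P(T^f x) from F to the index set of P.  Hence
the covering number of a measure depends only on the law it gives to names
([cov_le_law]): a cover of most of the space may be replaced by the cover by
all points having the same names.

Thus it suffices that, for almost every y, the law of P-names under mu_y is the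
law of P'-names under mu'_(phi y).  For each single set of names this is an
instance of the essential uniqueness of disintegrations
([disintegration_factor]): both sides, integrated over any measurable set of y,
give the same measure of an event upstairs, because phi is invertible modulo
null sets and phibar carries mu to mu'.  There are only finitely many names
over the finite set F, so the exceptional null sets can be collected.

The resulting inequality between covering numbers, valid for almost every y,
passes to the relative covering numbers because a measurable set S of Y can be
transported to Y' along the inverse of phi after removing null sets
([rel_cov_le]); the limits superior and suprema are then monotone.

The argument is carried out for each member F_n of the sequence separately. *)

(** * Measurability and almost everywhere equality *)

Lemma measurable_preimage d d' (T : measurableType d) (T' : measurableType d')
    (f : T -> T') (B : set T') :
  measurable_fun setT f -> measurable B -> measurable (f @^-1` B).
Proof. by move=> mf mB; rewrite -[_ @^-1` _]setTI; exact: mf. Qed.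

(** Needed because a disintegration is required to be carried by the fibres over
points, and the value of a measure on such a fibre is only meaningful once the
fibre is known to be measurable. *)
Lemma standard_borel_set1 (R : realType) d (T : measurableType d) (x : T) :
  standard_borel R T -> measurable [set x].
Proof.
move=> [M [f [_ _ _ mE]]]; apply/mE; rewrite image_set1 -[[set f x]]setCK.
rewrite -[~` _]setTD; apply: sigma_algebraCD.
apply: sub_sigma_algebra; apply: closed_openC.
by apply: accessible_closed_set1; apply: hausdorff_accessible;
  exact: metric_hausdorff.
Qed.

Section AlmostEverywhere.
Context {R : realType} d (T : measurableType d).
Context (mu : {measure set T -> \bar R}).

Lemma le_measure_ae (A B : set T) : measurable A -> measurable B ->
  {ae mu, forall x, A x -> B x} -> (mu A <= mu B)%E.
Proof.
move=> mA mB [N [mN N0 AN]]; apply: (@le_trans _ _ (mu (B `|` N))).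
  apply: le_measure; rewrite ?inE//; first exact: measurableU.
  move=> x Ax; have [Bx|nBx] := pselect (B x); first by left.
  by right; apply: AN => /(_ Ax).
rewrite (le_trans (measureU2 _ _ _))//.
by rewrite [X in (_ + X)%E](_ : _ = 0%E)// adde0.
Qed.

Lemma eq_measure_ae (A B : set T) : measurable A -> measurable B ->
  {ae mu, forall x, A x <-> B x} -> mu A = mu B.
Proof.
move=> mA mB AB; apply/eqP; rewrite eq_le; apply/andP; split;
  by apply: le_measure_ae => //; apply: filterS AB => x [].
Qed.

Lemma measure_setI_full (A C : set T) : mu setT = 1%E ->
  measurable A -> measurable C -> mu C = 1%E -> mu (A `&` C) = mu A.
Proof.
move=> mu1 mA mC muC; apply: eq_measure_ae => //; first exact: measurableI.
exists (~` C); split; first exact: measurableC.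
  have muTC : mu (setT `&` C) = 1%E by rewrite setTI.
  rewrite -setTD measureD//; last by rewrite [X in (X < _)%E]mu1 ltry.
  by rewrite [X in (X - _)%E]mu1 [X in (_ - X)%E]muTC subee.
by move=> x /= nAC Cx; apply: nAC; split=> [[]|].
Qed.

Lemma ge0_integral_ae_eq_domain (A B : set T) (f : T -> \bar R) :
  measurable A -> measurable B -> measurable_fun setT f ->
  (forall x, (0 <= f x)%E) -> {ae mu, forall x, A x <-> B x} ->
  (\int[mu]_(x in A) f x = \int[mu]_(x in B) f x)%E.
Proof.
move=> mA mB mf f0 AB; rewrite integral_mkcond [RHS]integral_mkcond.
have m_ C : measurable C -> measurable_fun setT (f \_ C).
  by move=> mC; apply/(measurable_restrictT f mC); exact: measurable_funTS.
have ge0 C x : (0 <= (f \_ C) x)%E by apply: erestrict_ge0 => y _.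
apply: ge0_ae_eq_integral => //; [exact: m_|exact: m_|].
apply: filterS AB => x AB _; rewrite !patchE.
by have -> : (x \in A) = (x \in B) by apply/idP/idP; rewrite !inE => /AB.
Qed.

Lemma ae_preimage d' (T' : measurableType d') (mu' : {measure set T' -> \bar R})
    (f : T -> T') (P : T' -> Prop) :
  measurable_fun setT f ->
  (forall B, measurable B -> pushforward mu f B = mu' B) ->
  {ae mu', forall y, P y} -> {ae mu, forall x, P (f x)}.
Proof.
move=> mf fE [N [mN N0 PN]]; exists (f @^-1` N); split.
- exact: measurable_preimage.
- by rewrite -N0 -fE.
- by move=> x nPx; exact: PN.
Qed.

End AlmostEverywhere.

(** * Disintegrations *)

Section Disintegration.
Context {R : realType} {G : groupType}.

(** For almost every y the measure k y lives on the fibre over y, so it sees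
all of A when y is in B, and nothing of the part of A over B otherwise. *)
Lemma disintegration_integral (X Y : mp_system R G) (p : X -> Y)
    (k : R.-pker Y ~> X) (A : set X) (B : set Y) :
  measurable_fun setT p -> is_disintegration p k ->
  measurable A -> measurable B ->
  sys_measure X (A `&` p @^-1` B) = (\int[sys_measure Y]_(y in B) k y A)%E.
Proof.
move=> mp [kE kfib] mA mB.
have mpB : measurable (p @^-1` B) by exact: measurable_preimage.
rewrite kE; last exact: measurableI.
rewrite [RHS]integral_mkcond; apply: ge0_ae_eq_integral => //.
- by apply: measurable_kernel; exact: measurableI.
- by apply/(measurable_restrictT _ mB); apply: measurable_funTS;
    exact: measurable_kernel.
- by move=> y _; apply: erestrict_ge0.
apply: filterS kfib => y ky _; rewrite patchE.
have mfib : measurable (p @^-1` [set y]).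
  by apply: measurable_preimage => //;
    exact: standard_borel_set1 (sys_standard Y).
case: ifPn => [|] yB; rewrite -(measure_setI_full _ _ mfib ky) ?prob_kernel//.
- rewrite -[in RHS](measure_setI_full _ _ mfib ky) ?prob_kernel//.
  congr (k y _); apply/seteqP; split=> x /= [].
    by move=> [Ax _] px.
  by move=> Ax px; split=> //; split=> //; rewrite px -inE.
- exact: measurableI.
- rewrite (_ : _ `&` _ = set0) ?measure0// -subset0 => x /= [[_ +] px].
  by rewrite px => /mem_set; rewrite (negPf yB).
- exact: measurableI.
Qed.
(** Essential uniqueness of the disintegration, moved along the factor map.
Allowing A to agree with the preimage of A' only up to a null set makes the
lemma applicable to events defined through the action, since phibar is
equivariant only almost everywhere. *)
Lemma disintegration_factor (X Y X' Y' : mp_system R G)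
    (pi : X -> Y) (pi' : X' -> Y') (phibar : X -> X') (phi : Y -> Y')
    (k : R.-pker Y ~> X) (k' : R.-pker Y' ~> X') (A : set X) (A' : set X') :
  factor_map pi -> factor_map pi' -> factor_map phibar ->
  system_isomorphism phi ->
  {ae sys_measure X, forall x, pi' (phibar x) = phi (pi x)} ->
  is_disintegration pi k -> is_disintegration pi' k' ->
  measurable A -> measurable A' ->
  {ae sys_measure X, forall x, A x <-> A' (phibar x)} ->
  {ae sys_measure Y, forall y, k y A = k' (phi y) A'}.
Proof.
move=> [mpi piE _] [mpi' _ _] [mpb pbE _] [[mphi phiE _] [q [mq qphi _]]].
move=> comm kdis k'dis mA mA' AA'.
have mk : measurable_fun setT (fun y => k y A) by exact: measurable_kernel.
have mk' : measurable_fun setT (fun y => k' y A') by exact: measurable_kernel.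
have mkphi : measurable_fun setT (fun y => k' (phi y) A').
  exact: (measurableT_comp mk' mphi).
suff : ae_eq (sys_measure Y) setT (fun y => k y A) (fun y => k' (phi y) A').
  by apply: filterS => y /(_ I).
apply: integral_ae_eq => //.
  apply/integrableP; split=> //.
  apply: (@le_lt_trans _ _ (\int[sys_measure Y]_y cst 1%E y)%E).
    apply: ge0_le_integral => //.
    - exact: measurableT_comp.
    - move=> y _; rewrite gee0_abs//= -(@prob_kernel _ _ _ _ _ k y).
      by apply: le_measure; rewrite ?inE.
  by rewrite integral_cst// mul1e [X in (X < _)%E]probability_setT ltry.
(* Both integrals over B are the measure of the part over B of the same event:
   the left one directly, the right one after replacing B by the preimage
   under phi of q @^-1` B, which differs from B by a null set, and changing
   variables along phi. *)
move=> B _ mB; rewrite -(disintegration_integral mpi kdis mA mB).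
have mB' : measurable (q @^-1` B) by exact: measurable_preimage.
rewrite (@ge0_integral_ae_eq_domain _ _ _ _ B (phi @^-1` (q @^-1` B)))//; first last.
- by apply: filterS qphi => y /= ->.
- exact: measurable_preimage.
have := ge0_integral_pushforward mphi (sys_measure Y) mB'
  (measurable_funTS mk') (fun y _ => measure_ge0 _ _).
rewrite /comp /= => <-.
rewrite (eq_measure_integral (sys_measure Y')); last by move=> C mC _; exact: phiE.
rewrite -(disintegration_integral mpi' k'dis mA' mB').
have mE : measurable (A' `&` pi' @^-1` (q @^-1` B)).
  by apply: measurableI => //; exact: measurable_preimage.
rewrite -pbE//; apply: eq_measure_ae.
- by apply: measurableI => //; exact: measurable_preimage.
- exact: measurable_preimage.
have qphipi := ae_preimage mpi piE qphi.
apply: filterS3 AA' comm qphipi => x AA' cx qx /=.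
by rewrite cx qx; split=> -[/AA' ? ?].
Qed.

End Disintegration.

(** * Covering numbers and laws of names *)

Section Names.
Context {R : realType} {G : groupType}.

(** The finite type of values is what lets statements about all events defined
by names hold outside a single null set. *)
Definition name (X : mp_system R G) (P : fin_partition X) (F : {fset G})
    (x : X) : {ffun F -> 'I_(fp_card P)} :=
  [ffun f => P (sys_act (val f) x)].

Lemma name_measurable (X : mp_system R G) (P : fin_partition X)
    (F : {fset G}) W : measurable (name P F @^-1` W).
Proof.
rewrite (_ : _ @^-1` _ = \bigcup_(a in W) \bigcap_(f in [set: F])
    (sys_act (val f) @^-1` (P @^-1` [set a f]))); last first.
  apply/seteqP; split=> x /=.
    by move=> Wx; exists (name P F x) => // f _ /=; rewrite ffunE.
  move=> [a Wa xa]; rewrite (_ : name P F x = a)//.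
  by apply/ffunP => f; rewrite ffunE; apply: xa.
apply: fin_bigcup_measurable => // a _.
apply: fin_bigcap_measurable => [|f _]; first exact: finite_finset.
apply: measurable_preimage; first exact: sys_act_measurable.
exact: fp_measurable.
Qed.

Lemma hamming_name (X : mp_system R G) (P : fin_partition X) (F : {fset G})
    (x x' : X) :
  hamming P F x x' =
    #|` F|%:R^-1 * \sum_(f : F) (name P F x f != name P F x' f)%:R.
Proof.
rewrite /hamming big_seq_fsetE /=; congr (_ * _).
by apply: eq_bigr => f _; rewrite !ffunE.
Qed.

Lemma hamming_le_diam (X : mp_system R G) (P : fin_partition X) (F : {fset G})
    (E : set X) (x x' : X) : E x -> E x' -> hamming P F x x' <= diam P F E.
Proof.
move=> Ex Ex'.
(* The set of distances is bounded, so that its supremum is an upper bound. *)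
apply: ub_le_sup; last by exists x, x'.
exists (#|` F|%:R^-1 * \sum_(f : F) 1) => _ [y [y' [_ _ ->]]].
rewrite hamming_name ler_wpM2l ?invr_ge0//; apply: ler_sum => f _.
by case: (_ != _).
Qed.

Lemma diam_le (X : mp_system R G) (P : fin_partition X) (F : {fset G})
    (E : set X) (eps : R) : 0 <= eps ->
  (forall x x', E x -> E x' -> hamming P F x x' <= eps) -> diam P F E <= eps.
Proof.
move=> eps0 Eeps; rewrite /diam; set H := [set r | _].
have [->|H0] := eqVneq H set0; first by rewrite sup0.
apply: ge_sup; first exact/set0P.
by move=> _ [x [x' [Ex Ex' ->]]]; exact: Eeps.
Qed.

Definition pull_partition d d' (T : measurableType d) (T' : measurableType d')
    (h : T -> T') (mh : measurable_fun setT h) (P : fin_partition T') :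
    fin_partition T :=
  @FinPartition d T (fp_card P) (P \o h)
    (fun i => measurable_preimage mh (fp_measurable i)).

(** Each E i is replaced by the set of points of X' whose name already occurs in
E i.  These sets have the same distances, and their union is an event defined
by names which, read in X, contains the union of the E i. *)
Lemma cov_le_law (X X' : mp_system R G) (h : X -> X')
    (mh : measurable_fun setT h) (P : fin_partition X') (F : {fset G}) (eps : R)
    (lam : {measure set X -> \bar R}) (lam' : {measure set X' -> \bar R}) :
  0 <= eps ->
  (forall W, lam (name (pull_partition mh P) F @^-1` W)
             = lam' (name P F @^-1` W)) ->
  (cov lam' P F eps <= cov lam (pull_partition mh P) F eps)%E.
Proof.
move=> eps0 law; set Q := pull_partition mh P.
apply: le_ereal_inf => _ [M [E [mE dE covE]] <-]; exists M => //.
pose nE i := name Q F @` E i.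
exists (fun i => name P F @^-1` (nE i)); split.
- by move=> i; exact: name_measurable.
- move=> i; apply: diam_le => // x x' [z Ez zx] [z' Ez' zx'].
  rewrite (le_trans _ (dE i))// (le_trans _ (hamming_le_diam _ _ Ez Ez'))//.
  rewrite !hamming_name ler_wpM2l ?invr_ge0// le_eqVlt; apply/orP; left.
  by apply/eqP; apply: eq_bigr => f _; rewrite -zx -zx'.
apply: le_trans covE _; rewrite -preimage_bigcup -law.
apply: le_measure; rewrite ?inE.
- by apply: fin_bigcup_measurable => //; exact: finite_finset.
- exact: name_measurable.
- by move=> x [i _ Ex]; exists i => //; exists x.
Qed.

End Names.
(** * Relative covering numbers *)

Section RelativeCover.
Context {R : realType} {G : groupType}.

Lemma name_factor (X X' : mp_system R G) (h : X -> X')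
    (mh : measurable_fun setT h) (P : fin_partition X') (F : {fset G}) :
  factor_map h ->
  {ae sys_measure X, forall x,
    name (pull_partition mh P) F x = name P F (h x)}.
Proof.
move=> [_ _ hT].
have hTF : {ae sys_measure X, forall x, forall f : F,
    h (sys_act (val f) x) = sys_act (val f) (h x)}.
  by apply: filter_forall => f; exact: hT.
apply: filterS hTF => x hx.
by apply/ffunP => f; rewrite !ffunE /= hx.
Qed.

(** An admissible set S for k is transported to Y' by the inverse q of phi.
Removing the null set N where the comparison fails, and the null set N' where
q is not a right inverse of phi, makes the comparison available at every point
of the new set and does not lower its measure. *)
Lemma rel_cov_le (X Y X' Y' : mp_system R G) (phi : Y -> Y')
    (k : R.-pker Y ~> X) (k' : R.-pker Y' ~> X')
    (P : fin_partition X) (P' : fin_partition X') (F : {fset G}) (eps : R) :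
  system_isomorphism phi ->
  {ae sys_measure Y, forall y,
    (cov (k' (phi y)) P' F eps <= cov (k y) P F eps)%E} ->
  (rel_cov k' P' F eps <= rel_cov k P F eps)%E.
Proof.
move=> [[mphi phiE _] [q [mq qphi phiq]]] [N [mN N0 NE]].
have [N' [mN' N'0 N'E]] := phiq.
apply: le_ereal_inf_tmp => _ [S [mS Seps] <-].
pose S' := (q @^-1` (S `\` N)) `\` N'.
have mS' : measurable S'.
  by apply: measurableD => //; apply: measurable_preimage => //; exact: measurableD.
apply: (@le_trans _ _ (maxe 0%E
  (ereal_sup [set cov (k' y') P' F eps | y' in S']))); last first.
  rewrite ge_max le_max lexx/= le_max; apply/orP; right.
  apply: ge_ereal_sup => _ [y' [[Sy Ny] N'y'] <-].
  have phiqy : phi (q y') = y' by apply: contrapT => /N'E.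
  apply: (@le_trans _ _ (cov (k (q y')) P F eps)); last first.
    by apply: ereal_sup_ubound; exists (q y').
  rewrite -{1}phiqy.
  by apply: contrapT => /NE.
apply: ereal_inf_lbound; exists S' => //; split=> //.
apply: le_trans Seps _; rewrite -phiE//.
apply: le_measure_ae => //; first exact: measurable_preimage.
have aeN : {ae sys_measure Y, forall y, ~ N y}.
  by exists N; split=> // y /= /contrapT.
have aeN' : {ae sys_measure Y', forall y, ~ N' y}.
  by exists N'; split=> // y /= /contrapT.
have aephiN' := ae_preimage mphi phiE aeN'.
by apply: filterS3 qphi aeN aephiN' => y qy Ny N'y Sy; split=> //=; rewrite qy.
Qed.

Lemma limn_esup_le (u v : nat -> \bar R) :
  (forall n, (u n <= v n)%E) -> (limn_esup u <= limn_esup v)%E.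
Proof.
move=> uv; rewrite /limn_esup !limf_esupE.
apply: le_ereal_inf_tmp => _ [V FV <-].
apply: (@le_trans _ _ (ereal_sup [set u n | n in V])).
  by apply: ereal_inf_lbound; exists V.
apply: ge_ereal_sup => _ [n Vn <-].
by apply: (le_trans (uv n)); apply: ereal_sup_ubound; exists n.
Qed.

End RelativeCover.

Theorem theorem2p3 (R : realType) (G : groupType)
    (G_countable : countable [set: G]) (G_amenable : amenable R G)
    (X Y X' Y' : mp_system R G)
    (pi : X -> Y) (pi_ext : factor_map pi)
    (pi' : X' -> Y') (pi'_ext : factor_map pi')
    (phibar : X -> X') (phibar_factor : factor_map phibar)
    (phi : Y -> Y') (phi_iso : system_isomorphism phi)
    (comm : {ae sys_measure X, forall x, pi' (phibar x) = phi (pi x)})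
    (mu_ : R.-pker Y ~> X) (mu_disint : is_disintegration pi mu_)
    (mu'_ : R.-pker Y' ~> X') (mu'_disint : is_disintegration pi' mu'_)
    (U : nat -> R) (U_rate : rate_function U)
    (F : nat -> {fset G}) (F_folner : folner_sequence R F) :
  (rel_slow_entropy mu'_ U F <= rel_slow_entropy mu_ U F)%E.
Proof.
have [mpb _ _] := phibar_factor.
have [U_gt0 _ _] := U_rate.
apply: ge_ereal_sup => _ [P' _ <-].
set P := pull_partition mpb P'.
apply: (@le_trans _ _ (rel_slow_entropy_part mu_ U F P)); last first.
  by apply: ereal_sup_ubound; exists P.
apply: ge_ereal_sup => _ [eps eps0 <-].
apply: (@le_trans _ _ (limn_esup
    (fun n => rel_cov mu_ P (F n) eps / (U #|` F n|)%:E)%E)); last first.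
  by apply: ereal_sup_ubound; exists eps.
apply: limn_esup_le => n; apply: lee_wpmul2r.
  by rewrite inver gt_eqF// lee_fin invr_ge0 ltW.
apply: (rel_cov_le phi_iso).
have law : {ae sys_measure Y, forall y,
    forall W : {set {ffun F n -> 'I_(fp_card P')}},
    mu_ y (name P (F n) @^-1` [set` W])
    = mu'_ (phi y) (name P' (F n) @^-1` [set` W])}.
  apply: filter_forall => W.
  apply: (disintegration_factor pi_ext pi'_ext phibar_factor phi_iso comm
    mu_disint mu'_disint); [exact: name_measurable|exact: name_measurable|].
  by apply: filterS (name_factor mpb P' (F n) phibar_factor) => x /= ->.
apply: filterS law => y lawy; apply: cov_le_law; first exact: ltW.
(* Every set of names is one of the finitely many decidable ones. *)
move=> W; have -> : W = [set` [set a | a \in W]%SET].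
  by apply/seteqP; split=> a /=; rewrite !inE.
exact: lawy.
Qed.
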